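(* Let $\lambda_A,\lambda_B>0$ and let $k\ge 1$ be an integer. Let the $B$-points form a homogeneous Poisson point process on $\mathbb{R}$ with intensity $\lambda_B$, and let the $A$-points form an independent homogeneous Poisson point process on $\mathbb{R}$ with intensity $\lambda_A$. Every $A$-point is connected to its $k$ nearest $B$-points. Then the degree $D_B$ of a randomly chosen (typical) $B$-point has distribution $$\mathbb{P}(D_B=n)=\frac{\Gamma(2k+n)}{n!\,\Gamma(2k)}\,\frac{(2\lambda_B)^{2k}\,\lambda_A^{n}}{(2\lambda_B+\lambda_A)^{2k+n}},\qquad n=0,1,2,\dots$$
   Context: The graph is the $k$-connected $AB$ random geometric graph: each $A$-point is joined by an edge to the $k$ points of $B$ closest to it in Euclidean distance (ties almost surely do not occur). The degree of a $B$-point is the number of $A$-points connected to it. A randomly chosen $B$-point is understood as the typical point of the Poisson process: the $B$-points are written in increasing order as $(B_i)_{i\in\mathbb{Z}}$, where the spacings $D_i=B_i-B_{i-1}$, $i\in\mathbb{Z}$, are i.i.d. exponential random variables with parameter (rate) $\lambda_B$, and $D_B$ is the degree of a point $B_i$ with fixed index $i$ (for instance $B_0$ placed at the origin). The $A$-process is independent of $(B_i)_{i\in\mathbb{Z}}$. $\Gamma$ denotes the Gamma function. *)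

(* Defs.v *)
From HB Require Import structures.
From mathcomp Require Import all_boot all_order all_algebra finmap.
From mathcomp Require Import all_classical all_reals all_analysis.
From mathcomp Require Import measurable_realfun.

Set Implicit Arguments.
Unset Strict Implicit.
Unset Printing Implicit Defensive.

Import Order.TTheory GRing.Theory Num.Theory.
Import numFieldNormedType.Exports.

Local Open Scope classical_set_scope.
Local Open Scope ring_scope.

Definition Gamma (R : realType) (a : R) : R :=
  \int[lebesgue_measure]_(t in `]0, +oo[) (t `^ (a - 1) * expR (- t)).

Section independence.
Context d (T : measurableType d) (R : realType) (P : probability T R).

Definition mutually_independent d' (T' : measurableType d') (I : eqType)
    (X : I -> T -> T') : Prop :=
  forall (s : seq I) (F : I -> set T'), uniq s ->
    (forall i, measurable (F i)) ->
    P (\bigcap_(i in [set` s]) (X i @^-1` F i)) =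
      (\prod_(i <- s) P (X i @^-1` F i))%E.

Definition sigma_generated d' (T' : measurableType d') (I : Type)
    (D : set I) (X : I -> T -> T') : set (set T) :=
  <<s \bigcup_(i in D) preimage_set_system [set: T] (X i) measurable >>.

Definition independent_systems (G H : set (set T)) : Prop :=
  forall U V, G U -> H V -> P (U `&` V) = (P U * P V)%E.

End independence.

Section point_process.
Context d (T : measurableType d) (R : realType).

Definition number_of_points (A : T -> set R) (E : set R) (w : T) : \bar R :=
  counting (A w `&` E).

(* The Poisson probabilities are written out because [poisson_pmf] is not the
   point mass at 0 when the rate is 0, i.e. for E of measure 0. *)
Record poisson_point_process (P : probability T R) (lambda : R)
    (A : T -> set R) : Prop := PoissonPointProcess {
  ppp_locally_finite :
    forall w a b, finite_set (A w `&` `[a, b]) ;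
  ppp_measurable : forall E, measurable E ->
    measurable_fun [set: T] (number_of_points A E) ;
  ppp_law : forall E, measurable E -> (lebesgue_measure E < +oo)%E ->
    forall n : nat,
      let r := lambda * fine (lebesgue_measure E) in
      P [set w | number_of_points A E w = n%:R%:E] =
        (r ^+ n / n`!%:R * expR (- r))%:E ;
  ppp_independent : forall (m : nat) (E : 'I_m -> set R),
    (forall j, measurable (E j)) -> trivIset [set: 'I_m] E ->
    mutually_independent P (fun j => number_of_points A (E j)) }.

Definition spacing (P : probability T R) (B : int -> {RV P >-> R})
  (i : int) : {RV P >-> R} := B i \- B (i - 1).

(* Seen from its point of index 0 (or of any fixed index), a homogeneous
   Poisson process of rate lambda is a two-sided renewal sequence with
   exponential spacings. The location of the process is left free. *)
Record typical_poisson_sequence (P : probability T R) (lambda : R)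
    (B : int -> {RV P >-> R}) : Prop := TypicalPoissonSequence {
  tps_increasing : forall w (i j : int), i < j -> B i w < B j w ;
  tps_law : forall i F, measurable F ->
    distribution P (spacing B i) F = exponential_prob lambda F ;
  tps_independent : mutually_independent P (fun i => spacing B i : T -> R) }.

Definition independent_processes (P : probability T R) (A : T -> set R)
    (B : int -> {RV P >-> R}) : Prop :=
  independent_systems P
    (sigma_generated measurable (number_of_points A))
    (sigma_generated [set: int] (fun i => B i : T -> R)).

End point_process.

Section AB_graph.
Context (R : realType).

(* Points are identified by their index, as [b] is increasing. In case of a tie
   several sets qualify; this almost surely does not happen. *)
Definition k_nearest (k : nat) (b : int -> R) (a : R) (J : {fset int}) : Prop :=
  #|` J| = k /\
  forall i j, i \in J -> j \notin J -> `|b i - a| <= `|b j - a|.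

Definition AB_edge (k : nat) (b : int -> R) (a : R) (i : int) : Prop :=
  exists2 J : {fset int}, k_nearest k b a J & i \in J.

Definition B_degree (k : nat) (A : set R) (b : int -> R) (i : int) : \bar R :=
  counting [set a | A a /\ AB_edge k b a i].

End AB_graph.

(* Main.v *)
Require Import Defs.
From HB Require Import structures.
From mathcomp Require Import all_boot all_order all_algebra finmap.
From mathcomp Require Import all_classical all_reals all_analysis.
From mathcomp Require Import measurable_realfun.
From mathcomp Require Import zify ring lra.

Set Implicit Arguments.
Unset Strict Implicit.
Unset Printing Implicit Defensive.

Import Order.TTheory GRing.Theory Num.Theory.
Import numFieldNormedType.Exports.

Local Open Scope classical_set_scope.
Local Open Scope ring_scope.

(** Let [b] be the increasing sequence of B-points. An A-point at [a] counts
    [b i] among its [k] nearest B-points exactly when [b i] is at least as close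
    to [a] as [b (i - k)] and as [b (i + k)]: were [b (i + k)] strictly closer,
    so would be the [k] points after [b i]. Hence the A-points joined to [b i]
    are those in the interval between the midpoints of [b (i - k), b i] and of
    [b i, b (i + k)] ([AB_edgeP]). Its length is half the distance from
    [b (i - k)] to [b (i + k)], that is, half the sum of [2 * k] independent
    exponential spacings.

    The A-process is independent of this random interval, so given the interval
    the degree is Poisson with mean [lambdaA] times its length
    ([law_count_random_interval]). Independence is only known between events,
    so the interval is first rounded outwards to a grid of mesh [1 / m.+1],
    where conditioning is a countable sum; as A is locally finite, the count in
    the rounded interval is eventually the right one, and dominated convergence
    concludes. The same approximation proves that the degree is measurable.

    It remains to average the Poisson probability over the length. A Poisson
    variable whose mean is a multiple of an exponential variable is geometric.
    A Poisson probability at a sum of means is a convolution of Poisson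
    probabilities, so averaging at a sum of [2 * k] independent exponential
    means yields a convolution of [2 * k] geometric laws, which is the claimed
    negative binomial law ([integral_poisson_mass_sum]). The Gamma function is
    only evaluated at positive integers, where it is a factorial
    ([Gamma_natE]). *)

(** * The A-points joined to a given B-point *)

Section edges.
Context (R : realType).
Implicit Types (b : int -> R) (a x y : R).

Lemma ler_dist_midl x y a : x < y -> (`|x - a| <= `|y - a|) = (a <= (x + y) / 2).
Proof.
move=> xy; apply/idP/idP; last first.
  by move=> h; rewrite ler_norml; case: (lerP a y) => ay; lra.
by rewrite ler_norml => /andP[]; case: (lerP a y) => ay; lra.
Qed.

Lemma ler_dist_midr x y a : x < y -> (`|y - a| <= `|x - a|) = ((x + y) / 2 <= a).
Proof.
move=> xy; have := @ler_dist_midl (- y) (- x) (- a); rewrite ltrN2 => /(_ xy).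
rewrite -!opprD !normrN => ->.
by apply/idP/idP => ?; lra.
Qed.

(** The place where a point moving to the right exchanges [b m] for [b (m + k)]
    among its [k] nearest neighbours. *)
Definition kmid (k : nat) b (m : int) : R := (b m + b (m + k)) / 2.

Definition window (k : nat) (m : int) : {fset int} :=
  [fset (m + Posz j)%R | j in iota 0 k]%fset.

Lemma in_window k m (j : int) : (j \in window k m) = (m <= j < m + k).
Proof.
apply/imfsetP/idP => /=.
  by move=> [l]; rewrite mem_iota add0n => /andP[_ lk] ->; lia.
move=> h; exists (absz (j - m)); last lia.
by rewrite mem_iota; lia.
Qed.

Lemma card_window k m : #|` window k m| = k.
Proof.
rewrite card_imfset /=; first by rewrite undup_id ?size_iota// iota_uniq.
by move=> x y /addrI [].
Qed.

(** A set of [k] nearest points containing [i] leaves out an element of any other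
    window of [k] indices, and this element cannot be strictly closer than [i];
    the windows on either side of [i] give the two bounds. Conversely the
    midpoints [kmid k b m] increase with [m], so the first one that is at least
    [a] determines a window of [k] consecutive nearest points, and the bounds
    say that [i] lies in it. *)
Lemma AB_edgeP k b a (i : int) : (0 < k)%N ->
  (forall i j, i < j -> b i < b j) ->
  AB_edge k b a i <-> kmid k b (i - Posz k) <= a <= kmid k b i.
Proof.
move=> k0 incb.
have leb m n : m <= n -> b m <= b n.
  by rewrite le_eqVlt => /predU1P[->//|/incb/ltW].
split=> [[J [cardJ nearJ] iJ]|].
- have noJ (W : {fset int}) : i \notin W -> #|` W| = k ->
      exists2 j, j \in W & `|b i - a| <= `|b j - a|.
    move=> iW cardW.
    case: (boolP (W `<=` J)%fset) => [WJ|].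
      have : W == J by rewrite eqEfcard WJ cardJ cardW/=.
      by move=> /eqP WE; rewrite WE iJ in iW.
    by move=> /fsubsetPn[j jW jJ]; exists j => //; exact: nearJ.
  apply/andP; split.
  + have [||j jW] := noJ (window k (i - Posz k)); rewrite ?card_window//.
      by rewrite in_window; lia.
    move: jW; rewrite in_window => /andP[j1 j2].
    rewrite ler_dist_midr; last by apply: incb; lia.
    rewrite /kmid subrK; apply: le_trans.
    by have := leb _ _ j1; lra.
  + have [||j jW] := noJ (window k (i + 1)); rewrite ?card_window//.
      by rewrite in_window; lia.
    move: jW; rewrite in_window => /andP[j1 j2].
    rewrite ler_dist_midl; last by apply: incb; lia.
    rewrite /kmid => /le_trans; apply.
    have /leb : j <= i + k by lia.
    lra.
- move=> /andP[aL aU].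
  have [m [im mi am aM]] : exists m : int, [/\ i - Posz k < m, m <= i,
      kmid k b (m - 1) <= a & a <= kmid k b m].
    have /ex_minnP[n an minn] :
        exists n : nat, a <= kmid k b (i - Posz k + 1 + Posz n).
      exists k.-1; rewrite (_ : _ + _ = i)//; lia.
    exists (i - Posz k + 1 + Posz n); split => //; first lia.
      have : (n <= k.-1)%N.
        by apply: minn; rewrite (_ : _ + _ = i)//; lia.
      lia.
    case: n an minn => [|n] an minn.
      have -> : i - Posz k + 1 + Posz 0 - 1 = i - Posz k by lia.
      exact: aL.
    have -> : i - Posz k + 1 + Posz n.+1 - 1 = i - Posz k + 1 + Posz n by lia.
    rewrite leNgt; apply/negP => /ltW/minn; lia.
  exists (window k m); last by rewrite in_window; lia.
  split; first exact: card_window.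
  move=> p q; rewrite !in_window => /andP[p1 p2].
  rewrite negb_and -!ltNge -leNgt => /orP[qm|mq].
  + rewrite ler_dist_midr; last by apply: incb; lia.
    apply: le_trans am; rewrite /kmid.
    have /leb : q <= m - 1 by lia.
    have /leb : p <= m - 1 + k by lia.
    lra.
  + rewrite ler_dist_midl; last by apply: incb; lia.
    apply: (le_trans aM); rewrite /kmid.
    have := leb _ _ mq; have := leb _ _ p1; lra.
Qed.

End edges.

(** * Integrals determined by their values on indicators *)

Section weighted_expectation.
Import HBNNSimple.
Local Open Scope ereal_scope.
Context (R : realType) d0 (S : measurableType d0).

Section one_side.
Context d (T : measurableType d) (mu : {measure set T -> \bar R}).
Context (H : T -> R) (X : T -> S).
Hypotheses (mH : measurable_fun [set: T] H) (H0 : forall w, (0 <= H w)%R).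
Hypothesis mX : measurable_fun [set: T] X.

Lemma weighted_integral_nnsfun (g : {nnsfun S >-> R}) :
  \int[mu]_w ((H w)%:E * (g (X w))%:E) =
  \sum_(r \in range g) r%:E * \int[mu]_w ((H w)%:E * (\1_(g @^-1` [set r]) (X w))%:E).
Proof.
have mI r : measurable_fun [set: T]
    (fun w => (H w)%:E * (\1_(g @^-1` [set r]) (X w))%:E : \bar R).
  apply: emeasurable_funM; first exact/measurable_EFinP.
  apply/measurable_EFinP.
  by apply: (@measurableT_comp _ _ _ _ _ _ (\1_(g @^-1` [set r]) : S -> R)).
have I0 r w : 0 <= (H w)%:E * (\1_(g @^-1` [set r]) (X w))%:E.
  by rewrite mule_ge0 ?lee_fin//.
transitivity (\int[mu]_w (\sum_(r \in range g)
    (r%:E * ((H w)%:E * (\1_(g @^-1` [set r]) (X w))%:E)))).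
  apply: eq_integral => w _; rewrite fimfunE -fsumEFin//.
  rewrite ge0_mule_fsumr//; last first.
    by move=> r; rewrite lee_fin; exact: nnfun_muleindic_ge0.
  by apply: eq_fsbigr => r _; rewrite EFinM muleCA.
rewrite ge0_integral_fsum//.
- apply: eq_fsbigr => r; rewrite inE => -[x _ <-].
  by rewrite ge0_integralZl// lee_fin.
- by move=> r; exact: measurable_funeM.
- move=> r w _; have [r0|r0] := leP 0%R r; first by rewrite mule_ge0.
  by rewrite preimage_nnfun0// indic0 mule0 mule0.
Qed.

Lemma weighted_integral_cvg (g : S -> \bar R) (mg : measurable_fun [set: S] g) :
  (forall x, 0 <= g x) ->
  \int[mu]_w ((H w)%:E * (nnsfun_approx measurableT mg n (X w))%:E) @[n --> \oo] -->
  \int[mu]_w ((H w)%:E * g (X w)).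
Proof.
move=> g0.
have -> : \int[mu]_w ((H w)%:E * g (X w)) =
    \int[mu]_w (limn (fun n => (H w)%:E * (nnsfun_approx measurableT mg n (X w))%:E)).
  apply: eq_integral => w _; apply/esym/cvg_lim => //.
  apply: cvgeZl => //; exact: cvg_nnsfun_approx.
apply: cvg_monotone_convergence => //.
- move=> n; apply: emeasurable_funM; apply/measurable_EFinP => //.
  exact: measurableT_comp.
- by move=> n w _; rewrite mule_ge0 ?lee_fin//.
- move=> w _ m n mn; rewrite lee_wpmul2l ?lee_fin//.
  exact: (lef_at (X w) (nd_nnsfun_approx measurableT mg)).
Qed.

End one_side.

(** The weights serve two purposes: a density turns an integral against a law
    into a Lebesgue integral, and the remaining factors of a product let
    independence be used for one factor at a time. *)
Lemma eq_weighted_integral d1 (T1 : measurableType d1)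
    (mu1 : {measure set T1 -> \bar R}) (H1 : T1 -> R) (X1 : T1 -> S)
    d2 (T2 : measurableType d2)
    (mu2 : {measure set T2 -> \bar R}) (H2 : T2 -> R) (X2 : T2 -> S) :
  measurable_fun [set: T1] H1 -> (forall w, (0 <= H1 w)%R) ->
  measurable_fun [set: T1] X1 ->
  measurable_fun [set: T2] H2 -> (forall w, (0 <= H2 w)%R) ->
  measurable_fun [set: T2] X2 ->
  (forall F, measurable F -> \int[mu1]_w ((H1 w)%:E * (\1_F (X1 w))%:E) =
                             \int[mu2]_w ((H2 w)%:E * (\1_F (X2 w))%:E)) ->
  forall g : S -> \bar R, measurable_fun [set: S] g -> (forall x, 0 <= g x) ->
  \int[mu1]_w ((H1 w)%:E * g (X1 w)) = \int[mu2]_w ((H2 w)%:E * g (X2 w)).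
Proof.
move=> mH1 H10 mX1 mH2 H20 mX2 eqI g mg g0.
have c1 := @weighted_integral_cvg _ _ mu1 H1 X1 mH1 H10 mX1 g mg g0.
have c2 := @weighted_integral_cvg _ _ mu2 H2 X2 mH2 H20 mX2 g mg g0.
apply: (cvg_unique _ c1) => //; apply: cvg_trans c2; apply: near_eq_cvg.
near=> n; rewrite !weighted_integral_nnsfun//; apply: eq_fsbigr => r _.
by rewrite eqI.
Unshelve. all: by end_near. Qed.

End weighted_expectation.

(** * Expectations of products of independent functions *)

Section independent_products.
Local Open Scope ereal_scope.
Context d (T : measurableType d) (R : realType) (P : probability T R).
Context d' (T' : measurableType d') (I : eqType) (X : I -> T -> T').
Hypothesis mX : forall i, measurable_fun [set: T] (X i).

Lemma prod_indic (s : seq I) (A : I -> set T) w :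
  (\prod_(i <- s) \1_(A i) w = \1_(\bigcap_(i in [set` s]) A i) w :> R)%R.
Proof.
rewrite [RHS]indicE; have [wA|] := boolP (w \in _).
  rewrite big_seq big1// => i si; rewrite indicE mem_set//.
  by move/set_mem: wA; apply.
move=> /negP wA; apply/eqP; rewrite prodf_seq_eq0.
apply: contra_notT wA => /hasPn wA; apply/mem_set => i /= /wA.
by rewrite /= indicE pnatr_eq0 eqb0 negbK inE.
Qed.

(** Independence of events is the case where all factors are indicators.
    The general case follows by releasing the factors one at a time: the list
    is split into arbitrary factors and indicators, and the identity for all
    indicators in place of one factor extends to that factor by
    [eq_weighted_integral]. *)
Lemma integral_prod_independent (f : I -> T' -> R) (s : seq I) :
  mutually_independent P X -> uniq s ->
  (forall i, measurable_fun [set: T'] (f i)) ->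
  (forall i x, (0 <= f i x)%R) ->
  (forall i, \int[P]_w (f i (X i w))%:E < +oo) ->
  \int[P]_w (\prod_(i <- s) f i (X i w))%:E =
  \prod_(i <- s) \int[P]_w (f i (X i w))%:E.
Proof.
move=> indX.
(* The factors in the second list are the indicators. *)
rewrite -[s]cats0.
have : forall i, i \in ([::] : seq I) ->
  exists2 F, measurable F & f i = \1_F by [].
elim: s [::] f => [|i s IH] t f ft us mf f0 foo.
  rewrite cat0s in us *.
  pose F i := f i @^-1` [set 1%R].
  have mF i : measurable (F i) by rewrite -[F i]setTI; exact: mf.
  have fF i : i \in t -> f i = \1_(F i).
    move=> /ft[G mG fG]; rewrite /F fG; congr indic.
    apply/seteqP; split=> x /=; first by rewrite indicE => xG; rewrite mem_set.
    by rewrite indicE; case: (boolP (x \in G)) => [/set_mem|_ /eqP]//;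
      rewrite eq_sym oner_eq0.
  have mXF i : measurable (X i @^-1` F i) by rewrite -[_ @^-1` _]setTI; exact: mX.
  transitivity (P (\bigcap_(i in [set` t]) (X i @^-1` F i))).
    have mcap : measurable (\bigcap_(i in [set` t]) (X i @^-1` F i)).
      apply/(measurable_indicP R).
      rewrite (_ : \1__ = fun w => (\prod_(i <- t) \1_(X i @^-1` F i) w)%R); last first.
        by apply/funext => w; rewrite prod_indic.
      by apply: measurable_prod => i _; exact: measurable_indic.
    rewrite -[X in P X]setIT -integral_indic//.
    apply: eq_integral => w _; rewrite -prod_indic; congr EFin.
    by apply: eq_big_seq => i /fF ->.
  rewrite indX//; apply: eq_big_seq => i it.
  by rewrite (fF _ it) -[X in P X]setIT -integral_indic.
pose H w := (\prod_(j <- s ++ t) f j (X j w))%R.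
pose C := \prod_(j <- s ++ t) \int[P]_w (f j (X j w))%:E.
have int0 j : 0 <= \int[P]_w (f j (X j w))%:E.
  by apply: integral_ge0 => w _; rewrite lee_fin.
have Cfin : C \is a fin_num.
  by apply: prode_fin_num => j _; rewrite ge0_fin_numE.
have Cge0 : 0 <= C by apply: prode_ge0 => j _.
have C0 : (0 <= fine C)%R by exact: fine_ge0.
have mH : measurable_fun [set: T] H.
  by apply: measurable_prod => j _; exact: measurableT_comp.
have H0 w : (0 <= H w)%R by apply: prodr_ge0.
transitivity (\int[P]_w ((H w)%:E * (f i (X i w))%:E)).
  by apply: eq_integral => w _; rewrite /= big_cons EFinM muleC.
rewrite (@eq_weighted_integral R _ T' _ T P H (X i) _ T P (cst (fine C)) (X i)
  mH H0 _ _ _ _ _ (EFin \o f i))//=; first last.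
- by move=> x; rewrite lee_fin.
- exact/measurable_EFinP.
- move=> F mF.
  (* The factor [i] is replaced by an indicator and joins the second list. *)
  pose f' j : T' -> R := if j == i then \1_F else f j.
  have f'E j : j \in s ++ t -> f' j = f j.
    by rewrite /f'; case: eqP => // -> it; move: us => /= /andP[/negP].
  have f'i : f' i = \1_F by rewrite /f' eqxx.
  have mIF : measurable_fun setT (\1_F : T' -> R) by exact: measurable_indic.
  have := IH (i :: t) f'; rewrite !big_cat/= !big_cons f'i.
  have -> : \int[P]_w (\prod_(j <- s ++ i :: t) f' j (X j w))%:E =
      \int[P]_w ((H w)%:E * (\1_F (X i w))%:E).
    apply: eq_integral => w _; rewrite -EFinM big_cat/= big_cons f'i mulrCA.
    rewrite -big_cat/= mulrC; congr (_ * _)%:E.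
    by apply: eq_big_seq => j /f'E ->.
  rewrite muleCA -big_cat/=.
  under eq_big_seq do rewrite f'E//.
  rewrite -/C => ->.
  + rewrite ge0_integralZl ?fineK 1?muleC//.
    * exact/measurable_EFinP/measurableT_comp.
  + move=> j; rewrite inE; case: eqVneq => [-> _|ji /=]; first by exists F.
    by move=> /ft; rewrite /f' (negPf ji).
  + by have := uniq_catCA s [:: i] t; rewrite /= => ->.
  + by move=> j; rewrite /f'; case: ifP.
  + by move=> j x; rewrite /f'; case: ifP.
  + move=> j; rewrite /f'; case: ifP => // _.
    have mXF : measurable (X j @^-1` F) by rewrite -[_ @^-1` _]setTI; exact: mX.
    rewrite (_ : \int[P]_w _ = \int[P]_w (\1_(X j @^-1` F) w)%:E)//.
    rewrite integral_indic// setIT (le_lt_trans (probability_le1 P mXF))//.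
    exact: ltry.
- rewrite ge0_integralZl ?fineK//=.
  + by rewrite muleC big_cons.
  + exact/measurable_EFinP/measurableT_comp.
  + by move=> w _; rewrite lee_fin.
Qed.

End independent_products.

(** * Poisson masses and the Gamma function at integers *)

Section poisson_mass.
Context (R : realType).
Implicit Types (r x b c : R) (n m : nat).

Definition poisson_mass r n : R := r ^+ n / n`!%:R * expR (- r).

Lemma poisson_mass_ge0 r n : 0 <= r -> 0 <= poisson_mass r n.
Proof. by move=> r0; rewrite mulr_ge0 ?expR_ge0// divr_ge0 ?exprn_ge0. Qed.

Lemma poisson_mass_le1 r n : 0 <= r -> poisson_mass r n <= 1.
Proof.
move=> r0; rewrite /poisson_mass expRN ler_pdivrMr ?expR_gt0// mul1r.
case: n => [|n].
  by rewrite expr0 divr1 (le_trans _ (expR_ge1Dx r))// lerDl.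
by rewrite (le_trans _ (expR_ge1Dxn n r0))// lerDr.
Qed.

Lemma poisson_mass0 n : poisson_mass 0 n = (n == 0)%:R.
Proof.
by rewrite /poisson_mass oppr0 expR0 mulr1; case: n => [|n];
  rewrite ?divr1// expr0n mul0r.
Qed.

(** Independent Poisson variables add up to a Poisson variable. *)
Lemma poisson_massD x y n :
  poisson_mass (x + y) n = \sum_(m < n.+1) poisson_mass x m * poisson_mass y (n - m).
Proof.
rewrite /poisson_mass addrC exprDn opprD expRD !mulr_suml; apply: eq_bigr => m _.
have mn : (m <= n)%N by rewrite -ltnS.
rewrite -(bin_fact mn) !natrM -mulr_natl.
field.
by rewrite !pnatr_eq0 -!lt0n !fact_gt0 bin_gt0 mn.
Qed.

Lemma continuous_poisson_mass n : continuous (poisson_mass ^~ n).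
Proof.
move=> x; rewrite /poisson_mass; apply: cvgM.
  by apply: cvgMr_tmp; exact: exprn_continuous.
apply: continuous_comp; last exact: continuous_expR.
exact: opp_continuous.
Qed.

Lemma poisson_mass_cvgy n : poisson_mass x n @[x --> +oo] --> (0 : R).
Proof.
apply/cvgrPdist_lt => e e0; near=> x.
have x0 : 0 < x by near: x; apply: nbhs_pinfty_gt; exact: num_real.
rewrite sub0r normrN ger0_norm ?poisson_mass_ge0 ?ltW//.
(* The exponential dominates the next power, which leaves a factor [1 / x]. *)
apply: (@le_lt_trans _ _ (n.+1%:R / x)); last first.
  rewrite ltr_pdivrMr// mulrC -ltr_pdivrMr//.
  by near: x; apply: nbhs_pinfty_gt; exact: num_real.
rewrite /poisson_mass expRN ler_pdivlMr// mulrAC ler_pdivrMr ?expR_gt0//.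
apply: (@le_trans _ _ (n.+1%:R * (x ^+ n.+1 / n.+1`!%:R))); last first.
  rewrite ler_wpM2l// (le_trans _ (expR_ge1Dxn n (ltW x0)))// lerDr//.
rewrite factS natrM exprSr le_eqVlt; apply/orP; left; apply/eqP.
field.
by rewrite nat1r !pnatr_eq0 -!lt0n !fact_gt0.
Unshelve. all: by end_near. Qed.

Lemma is_derive_poisson_mass0 x :
  is_derive x 1 (poisson_mass ^~ 0) (- poisson_mass x 0).
Proof.
rewrite /poisson_mass; under eq_fun do rewrite expr0 divr1 mul1r.
by apply: is_derive_eq; rewrite expr0 divr1 mul1r mulrN1.
Qed.

Lemma is_derive_poisson_massS x m :
  is_derive x 1 (poisson_mass ^~ m.+1) (poisson_mass x m - poisson_mass x m.+1).
Proof.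
have -> : poisson_mass ^~ m.+1 =
    (m.+1`!%:R^-1 *: ((fun x => x ^+ m.+1) * (fun x => expR (- x)))).
  apply/funext => y; transitivity (m.+1`!%:R^-1 * (y ^+ m.+1 * expR (- y))) => //.
  by rewrite /poisson_mass mulrA [_^-1 * _]mulrC.
have dX : is_derive x 1 (fun y : R => y ^+ m.+1) (m.+1%:R * x ^+ m).
  by apply: DeriveDef; [exact: exprn_derivable|rewrite exp_derive [LHS]mulr1].
apply: is_derive_eq; rewrite /poisson_mass /GRing.scale/= factS natrM.
field.
by rewrite nat1r !pnatr_eq0 -lt0n fact_gt0.
Qed.

(** The derivatives of the masses telescope. *)
Lemma is_derive_poisson_tail x m :
  is_derive x 1 (fun x => - \sum_(j < m.+1) poisson_mass x j) (poisson_mass x m).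
Proof.
elim: m => [|m IH].
  under eq_fun do rewrite big_ord_recr big_ord0/= add0r.
  have H := is_derive_poisson_mass0 x.
  by apply: is_derive_eq; rewrite opprK.
under eq_fun do rewrite big_ord_recr/= opprD.
have H := is_derive_poisson_massS x m.
by apply: is_derive_eq; rewrite subKr.
Qed.

(** The Erlang density integrates to [1]: its antiderivative is minus the
    probability that a Poisson variable of mean [b * x] is at most [m]. *)
Lemma integral_poisson_mass b m : 0 < b ->
  (\int[lebesgue_measure]_(x in `[0%R, +oo[) (b * poisson_mass (b * x) m)%:E = 1)%E.
Proof.
move=> b0.
have dF x : is_derive x 1 (fun x => - \sum_(j < m.+1) poisson_mass (b * x) j)
    (b * poisson_mass (b * x) m).
  rewrite mulrC; apply: (@is_derive1_comp R
    (fun y => - \sum_(j < m.+1) poisson_mass y j) ( *%R b)).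
    exact: is_derive_poisson_tail.
  by rewrite -[X in is_derive _ _ _ X]mulr1; exact: is_deriveZ.
rewrite (@ge0_continuous_FTC2y _ _
  (fun x => - \sum_(j < m.+1) poisson_mass (b * x) j) _ 0)//.
- rewrite mulr0 (eq_bigr (fun j : 'I_m.+1 => (j == 0)%:R)); last first.
    by move=> j _; rewrite poisson_mass0.
  by rewrite big_ord_recl/= big1// addr0 opprK add0e.
- by move=> x x0; rewrite (mulr_ge0 (ltW b0))// poisson_mass_ge0// (mulr_ge0 (ltW b0)).
- apply: continuous_subspaceT => x.
  apply: cvgM; first exact: cvg_cst.
  apply: (@continuous_comp _ _ _ ( *%R b) (poisson_mass ^~ m)); last first.
    exact: continuous_poisson_mass.
  exact: mulrl_continuous.
- rewrite -[X in _ --> X]oppr0; apply: cvgN.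
  elim: (m.+1) => [|j IH].
    by under eq_fun do rewrite big_ord0; exact: cvg_cst.
  under eq_fun do rewrite big_ord_recr/=.
  have cj : poisson_mass (b * x) j @[x --> +oo] --> (0 : R).
    apply: (@cvg_comp _ _ _ ( *%R b) (poisson_mass ^~ j)); last first.
      exact: poisson_mass_cvgy.
    exact: gt0_cvgMry.
  by have := cvgD IH cj; rewrite addr0; apply.
- apply: cvg_at_right_filter.
  by have [/derivable1_diffP/differentiable_continuous dF0 _] := dF 0; exact: dF0.
- by move=> x _; rewrite derive1E; have [_ ->] := dF x.
Qed.

Lemma Gamma_natE n : Gamma n.+1%:R = n`!%:R :> R.
Proof.
rewrite /Gamma /Rintegral.
have mg : measurable_fun [set: R] (fun t : R => n`!%:R * poisson_mass t n).
  apply: measurable_funM => //; apply: continuous_measurable_fun.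
  exact: continuous_poisson_mass.
transitivity (fine (\int[lebesgue_measure]_(t in `]0%R, +oo[)
    (n`!%:R * poisson_mass t n)%:E)).
  congr fine; apply: eq_integral => t; rewrite inE/= in_itv/= andbT => t0.
  congr EFin; rewrite -natr1 addrK powR_mulrn ?ltW// /poisson_mass.
  by field; rewrite pnatr_eq0 -lt0n fact_gt0.
rewrite integral_itv_obnd_cbnd; last first.
  by apply/measurable_EFinP; exact: measurable_funTS.
under eq_integral do rewrite EFinM.
rewrite ge0_integralZl//=.
- have := @integral_poisson_mass 1 n ltr01.
  by under eq_integral do rewrite !mul1r; move=> ->; rewrite mule1.
- apply/measurable_EFinP; apply: measurable_funTS.
  by apply: continuous_measurable_fun; exact: continuous_poisson_mass.
- by move=> x; rewrite in_itv/= andbT => x0; rewrite lee_fin poisson_mass_ge0.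
Qed.

(** A Poisson variable with exponential mean is geometric: up to constants the
    integrand is the Erlang density of rate [l + c]. The absolute value keeps the
    integrand nonnegative outside the support of the exponential law. *)
Lemma integral_exponential_poisson_mass l c m : 0 < l -> 0 < c ->
  (\int[lebesgue_measure]_x (exponential_pdf l x * poisson_mass (c * `|x|) m)%:E =
   (l / (l + c) * (c / (l + c)) ^+ m)%:E)%E.
Proof.
move=> l0 c0.
have lc0 : 0 < l + c by rewrite addr_gt0.
have mpm b : measurable_fun [set: R] (fun x : R => poisson_mass (b * x) m).
  apply: (@measurableT_comp _ _ _ _ _ _ (poisson_mass ^~ m)) => //.
  by apply: continuous_measurable_fun; exact: continuous_poisson_mass.
transitivity (\int[lebesgue_measure]_(x in `[0%R, +oo[)
    ((l / (l + c) * (c / (l + c)) ^+ m)%:E *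
     ((l + c) * poisson_mass ((l + c) * x) m)%:E))%E.
  rewrite [RHS]integral_mkcond; apply: eq_integral => x _.
  rewrite patchE /exponential_pdf patchE.
  case: ifPn => [|_]; last by rewrite mul0r.
  rewrite inE/= in_itv/= andbT => x0; rewrite -EFinM ger0_norm//; congr EFin.
  rewrite /poisson_mass !exprMn exprVn.
  have -> : - ((l + c) * x) = - l * x + - (c * x) by ring.
  rewrite expRD.
  field.
  by rewrite pnatr_eq0 -lt0n fact_gt0 expf_neq0 (gt_eqF lc0).
rewrite ge0_integralZl//=.
- by rewrite integral_poisson_mass// mule1.
- apply/measurable_EFinP; apply: measurable_funTS.
  by apply: measurable_funM => //; exact: mpm.
- move=> x; rewrite in_itv/= andbT => x0; rewrite lee_fin.
  by rewrite (mulr_ge0 (ltW lc0))// poisson_mass_ge0// (mulr_ge0 (ltW lc0)).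
- by rewrite lee_fin mulr_ge0 ?exprn_ge0 ?divr_ge0 ?ltW.
Qed.

End poisson_mass.

(** * Poisson mixtures over sums of exponential variables *)

(** The hockey-stick identity. With the predecessor, [N = 0] gives the point mass
    at [0], the law of an empty sum of geometric variables. *)
Lemma sum_bin_pred N n : (\sum_(m < n.+1) 'C((N + m).-1, m) = 'C(N + n, n))%N.
Proof.
elim: n => [|n IH]; first by rewrite big_ord1 !bin0.
by rewrite big_ord_recr/= IH addnS/= binS addnC.
Qed.

Section negative_binomial.
Context d (T : measurableType d) (R : realType) (P : probability T R).
Context (I : eqType) (X : I -> T -> R) (c p q : R).
Hypotheses (c0 : 0 < c) (mX : forall i, measurable_fun [set: T] (X i)).
Hypotheses (X0 : forall i w, 0 <= X i w) (indX : mutually_independent P X).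
Hypothesis EX : forall i m,
  (\int[P]_w (poisson_mass (c * `|X i w|) m)%:E = (p * q ^+ m)%:E)%E.

Let mg m : measurable_fun [set: R] (fun x : R => poisson_mass (c * `|x|) m).
Proof.
apply: (@measurableT_comp _ _ _ _ _ _ (@poisson_mass R ^~ m) _ (fun x : R => c * `|x|)).
  by apply: continuous_measurable_fun; exact: continuous_poisson_mass.
by apply: measurable_funM => //; exact: measurable_normr.
Qed.

Let g0 m (x : R) : 0 <= poisson_mass (c * `|x|) m.
Proof. by rewrite poisson_mass_ge0// mulr_ge0// ltW. Qed.

(** The product over [t] is what makes an induction on [s] possible: splitting
    the Poisson mass at [X j] plus a sum produces a factor that depends on [X j]
    alone, which joins that product. *)
Lemma integral_poisson_mass_sum_prod (s t : seq I) (f : I -> nat) n :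
  uniq (s ++ t) ->
  (\int[P]_w (poisson_mass (c * \sum_(i <- s) X i w) n *
      \prod_(i <- t) poisson_mass (c * `|X i w|) (f i))%:E =
   ('C((size s + n).-1, n)%:R * p ^+ size s * q ^+ n *
      \prod_(i <- t) (p * q ^+ f i))%:E)%E.
Proof.
elim: s t f n => [|j s IH] t f n ust.
  have := @integral_prod_independent _ _ _ P _ _ _ X mX
    (fun i x => poisson_mass (c * `|x|) (f i)) t indX ust.
  move=> /(_ _ _ _)/= prodE.
  under eq_integral do rewrite big_nil mulr0 poisson_mass0.
  case: n => [|n]; last first.
    under eq_integral do rewrite mul0r.
    by rewrite integral0 add0n/= bin_small// !mul0r.
  under eq_integral do rewrite mul1r.
  rewrite prodE//; last by move=> i; rewrite EX ltry.
  rewrite bin0 !mul1r.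
  by under eq_bigr do rewrite EX; rewrite prodEFin.
pose f' m i := if i == j then m else f i.
have jst : j \notin s ++ t by move: ust => /= /andP[].
have f'E m : \prod_(i <- t) (p * q ^+ f' m i) = \prod_(i <- t) (p * q ^+ f i).
  apply: eq_big_seq => i it; rewrite /f'; case: eqVneq => // ij.
  by move: jst; rewrite -ij mem_cat it orbT.
have f'wE m w : \prod_(i <- t) poisson_mass (c * `|X i w|) (f' m i) =
    \prod_(i <- t) poisson_mass (c * `|X i w|) (f i).
  apply: eq_big_seq => i it; rewrite /f'; case: eqVneq => // ij.
  by move: jst; rewrite -ij mem_cat it orbT.
pose h m w : R := poisson_mass (c * \sum_(i <- s) X i w) m *
      \prod_(i <- j :: t) poisson_mass (c * `|X i w|) (f' (n - m)%N i).
transitivity (\int[P]_w (\sum_(m < n.+1) (h m w)%:E))%E.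
  apply: eq_integral => w _; rewrite big_cons mulrDr addrC poisson_massD.
  rewrite mulr_suml -sumEFin; apply: eq_bigr => m _; congr EFin.
  by rewrite /h big_cons f'wE /f' eqxx ger0_norm// mulrA.
rewrite ge0_integral_sum//; first last.
- move=> m w _; rewrite lee_fin mulr_ge0//; last exact: prodr_ge0.
  by rewrite poisson_mass_ge0// mulr_ge0 ?sumr_ge0// ltW.
- move=> m; apply/measurable_EFinP; apply: measurable_funM.
    apply: (@measurableT_comp _ _ _ _ _ _ (@poisson_mass R ^~ m)).
      by apply: continuous_measurable_fun; exact: continuous_poisson_mass.
    by apply: measurable_funM => //; exact: measurable_sum.
  by apply: measurable_prod => i _; exact: (measurableT_comp (mg _)).
rewrite (eq_bigr (fun m : 'I_n.+1 => ('C((size s + m).-1, m)%:R *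
    (p ^+ (size s).+1 * q ^+ n * \prod_(i <- t) (p * q ^+ f i)))%:E)); last first.
  move=> m _; rewrite IH; last first.
    by have := uniq_catCA s [:: j] t; rewrite /= => ->.
  congr EFin; rewrite big_cons f'E /f' eqxx -!mulrA; congr (_ * _).
  rewrite exprS -[in RHS](subnKC (_ : m <= n)%N) ?exprD; last by rewrite -ltnS.
  by ring.
rewrite sumEFin -mulr_suml -natr_sum sum_bin_pred addSn/=.
by congr EFin; rewrite !mulrA.
Qed.

Lemma integral_poisson_mass_sum (s : seq I) n : uniq s ->
  (\int[P]_w (poisson_mass (c * \sum_(i <- s) X i w) n)%:E =
   ('C((size s + n).-1, n)%:R * p ^+ size s * q ^+ n)%:E)%E.
Proof.
move=> us; have := @integral_poisson_mass_sum_prod s [::] (fun=> 0%N) n.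
rewrite cats0 => /(_ us); rewrite big_nil mulr1 => <-.
by apply: eq_integral => w _; rewrite big_nil mulr1.
Qed.

End negative_binomial.

(** * Selection by a countably valued variable, and grids *)

Section countable_selection.
Context d (T : measurableType d) (R : realType).
Context (Z : T -> nat).
Hypothesis mZ : forall c, measurable (Z @^-1` [set c]).

Lemma measurable_selection d' (T' : measurableType d') (f : nat -> T -> T') :
  (forall c, measurable_fun [set: T] (f c)) ->
  measurable_fun [set: T] (fun w => f (Z w) w).
Proof.
move=> mf _ F mF; rewrite setTI.
rewrite (_ : _ @^-1` _ = \bigcup_c (Z @^-1` [set c] `&` f c @^-1` F)); last first.
  by apply/seteqP; split=> [w fw|w [c _ [/= -> ]]//]; exists (Z w).
apply: bigcup_measurable => c _; apply: measurableI => //.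
by rewrite -[X in measurable X]setTI; exact: mf.
Qed.

(** Conditioning on the countably valued [Z]. *)
Lemma probability_selection (P : probability T R) (E : nat -> set T)
    (r : nat -> R) :
  (forall c, measurable (E c)) -> (forall c, 0 <= r c) ->
  (forall c, P (Z @^-1` [set c] `&` E c) = P (Z @^-1` [set c]) * (r c)%:E)%E ->
  (P [set w | E (Z w) w] = \int[P]_w (r (Z w))%:E)%E.
Proof.
move=> mE r0 indE.
have tZ : trivIset [set: nat] (fun c => Z @^-1` [set c]).
  by apply/trivIsetP => a b _ _ /eqP ab; apply/seteqP; split=> w //= [->].
have ZT : [set: T] = \bigcup_c (Z @^-1` [set c]).
  by apply/seteqP; split=> // w _; exists (Z w).
have mr : measurable_fun [set: T] (fun w => (r (Z w))%:E).
  exact: (@measurable_selection _ _ (fun c _ => (r c)%:E)).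
rewrite [in RHS]ZT ge0_integral_bigcup//; first last.
- by move=> w _; rewrite lee_fin.
- by rewrite -ZT.
rewrite (_ : [set w | _] = \bigcup_c (Z @^-1` [set c] `&` E c)); last first.
  by apply/seteqP; split=> [w Ew|w [c _ [/= -> ]]//]; exists (Z w).
rewrite measure_semi_bigcup; first last.
- by apply: bigcup_measurable => c _; exact: measurableI.
- by apply/trivIsetP => a b _ _ /eqP ab; apply/seteqP; split=> w //= [[-> _] []].
- by move=> c; exact: measurableI.
apply: eq_eseriesr => c _; rewrite [LHS]indE.
rewrite (eq_integral (cst (r c)%:E)); last by move=> w /[!inE]/= ->.
by rewrite integral_cst// muleC.
Qed.

End countable_selection.

Section grid.
Context (R : realType).
Implicit Types (x y : R) (m : nat).

Definition grid_index m x : int := Num.floor (x * m.+1%:R).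
Definition grid_point m (p : int) : R := p%:~R / m.+1%:R.

Lemma grid_index_preimage m (p : int) :
  grid_index m @^-1` [set p] = `[grid_point m p, grid_point m (p + 1)[%classic.
Proof.
apply/seteqP; split=> x /=; rewrite in_itv/= /grid_point ler_pdivrMr// ltr_pdivlMr//.
  by move=> /eqP; rewrite floor_eq.
by rewrite -floor_eq => /eqP.
Qed.

Lemma grid_itv m x :
  grid_point m (grid_index m x) <= x < grid_point m (grid_index m x + 1).
Proof.
have : (grid_index m @^-1` [set grid_index m x]) x by [].
by rewrite grid_index_preimage/= in_itv.
Qed.

Lemma grid_pointS m (p : int) : grid_point m (p + 1) = grid_point m p + m.+1%:R^-1.
Proof. by rewrite /grid_point intrD mulrDl mul1r. Qed.

Lemma grid_lo_cvg x : grid_point m (grid_index m x) @[m --> \oo] --> x.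
Proof.
have xh : x - (@harmonic R m) @[m --> \oo] --> x.
  by rewrite -[X in _ --> X]subr0; apply: cvgB; [exact: cvg_cst|exact: cvg_harmonic].
apply: (squeeze_cvgr _ xh (cvg_cst x)); near=> m.
have := grid_itv m x; rewrite grid_pointS => /andP[-> /ltW xm].
by rewrite andbT lerBlDr.
Unshelve. all: by end_near. Qed.

Lemma grid_up_cvg x : grid_point m (grid_index m x + 1) @[m --> \oo] --> x.
Proof.
under eq_fun do rewrite grid_pointS.
by have := cvgD (@grid_lo_cvg x) (@cvg_harmonic R); rewrite addr0; apply.
Qed.

(** Outside [[a, b]] there are only finitely many points of [S] nearby, and each
    of them is eventually left out. *)
Lemma near_finite_setI (S : set R) (l u : nat -> R) (a b : R) :
  (forall x y, finite_set (S `&` `[x, y])) ->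
  (forall m, l m <= a) -> (forall m, b <= u m) ->
  l m @[m --> \oo] --> a -> u m @[m --> \oo] --> b ->
  \forall m \near \oo, S `&` `[l m, u m] = S `&` `[a, b].
Proof.
move=> finS la bu lc uc.
have : \forall m \near \oo,
    (\bigcap_(x in [set` fset_set (S `&` `[a - 1, b + 1])])
      [set m : nat | l m <= x <= u m -> a <= x <= b]) m.
  apply: filter_bigI => x _.
  have [xa|ax] := ltP x a.
    have : \forall m \near \oo, x < l m by exact: (cvgr_gt a).
    by apply: filterS => m xl /andP[/(lt_le_trans xl)]; rewrite ltxx.
  have [bx|xb] := ltP b x.
    have : \forall m \near \oo, u m < x by exact: (cvgr_lt b).
    by apply: filterS => m xl /andP[_ /le_lt_trans/(_ xl)]; rewrite ltxx.
  by apply: filterE.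
move=> H; near=> m.
apply/seteqP; split=> x [Sx]; rewrite /= !in_itv/= => /andP[x1 x2]; split => //.
  have Hm : forall x, x \in fset_set (S `&` `[a - 1, b + 1]) ->
    l m <= x <= u m -> a <= x <= b by near: m.
  apply: Hm; rewrite ?x1// in_fset_set// inE; split => //=; rewrite in_itv/=.
  apply/andP; split.
    apply: le_trans x1; near: m; apply: (cvgr_ge a) => //; lra.
  apply: (le_trans x2); near: m; apply: (cvgr_le b) => //; lra.
by rewrite (le_trans (la m))// (le_trans x2).
Unshelve. all: by end_near. Qed.

End grid.

Arguments grid_point {R}.

(** * Poisson points in an independent random interval *)

Section random_interval.
Context d (T : measurableType d) (R : realType) (P : probability T R).
Context (lambda : R) (A : T -> set R) (L U : T -> R) (G : set (set T)).
Hypotheses (lambda0 : 0 < lambda) (hA : poisson_point_process P lambda A).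
Hypotheses (LU : forall w, L w <= U w) (Gm : G `<=` measurable).
Hypothesis GLU : forall F F' : set R, measurable F -> measurable F' ->
  G (L @^-1` F `&` U @^-1` F').
Hypothesis AG :
  independent_systems P (sigma_generated measurable (number_of_points A)) G.

Let N w := counting (A w `&` `[L w, U w]) : \bar R.

(* [Z m] encodes the grid cells of the end points, and [box m (Z m w)] is the
   interval rounded outwards. *)
Let cell m w : int * int := (grid_index m (L w), grid_index m (U w)).
Let Z m w : nat := choice.pickle (cell m w).
Let box m (c : nat) : set R :=
  let pq := odflt (0, 0) (choice.unpickle c : option (int * int)) in
  `[grid_point m pq.1, grid_point m (pq.2 + 1)]%classic.

Let boxZ m w : box m (Z m w) =
  `[grid_point m (grid_index m (L w)), grid_point m (grid_index m (U w) + 1)]%classic.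
Proof. by rewrite /box /Z choice.pickleK. Qed.

Let GZ m c : G (Z m @^-1` [set c]).
Proof.
have [[w0 <-]|Z0] := pselect (exists w0, Z m w0 = c).
  rewrite (_ : _ @^-1` _ = L @^-1` (grid_index m @^-1` [set grid_index m (L w0)])
      `&` U @^-1` (grid_index m @^-1` [set grid_index m (U w0)])).
    by apply: GLU; rewrite grid_index_preimage; exact: measurable_itv.
  apply/seteqP; split=> w /=.
    by move=> /(pcan_inj choice.pickleK) [-> ->].
  by move=> [Lw Uw]; rewrite /Z /cell Lw Uw.
rewrite (_ : _ @^-1` _ = L @^-1` set0 `&` U @^-1` setT); first exact: GLU.
by apply/seteqP; split=> w /=; [move=> Zw; case: Z0; exists w|case].
Qed.

Let mZ m c : measurable (Z m @^-1` [set c]). Proof. exact/Gm/GZ. Qed.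

Let mbox m c : measurable (box m c). Proof. exact: measurable_itv. Qed.

Let Nm m w := number_of_points A (box m (Z m w)) w.

Let mNm m : measurable_fun [set: T] (Nm m).
Proof.
apply: (@measurable_selection _ _ _ (mZ m) _ _
  (fun c => number_of_points A (box m c))).
by move=> c; exact: (ppp_measurable hA).
Qed.

(* The approximating counts are eventually equal to [N], which gives both its
   measurability and its law. *)
Let near_Nm w : \forall m \near \oo, Nm m w = N w.
Proof.
have : \forall m \near \oo,
    A w `&` `[grid_point m (grid_index m (L w)), grid_point m (grid_index m (U w) + 1)] =
    A w `&` `[L w, U w].
  apply: near_finite_setI.
  - by move=> x y; exact: (ppp_locally_finite hA).
  - by move=> m; have /andP[] := grid_itv m (L w).
  - by move=> m; have /andP[_ /ltW] := grid_itv m (U w).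
  - exact: grid_lo_cvg.
  - exact: grid_up_cvg.
by apply: filterS => m; rewrite /Nm /N /number_of_points boxZ => ->.
Qed.

Lemma measurable_count_random_interval : measurable_fun [set: T] N.
Proof.
apply: (emeasurable_fun_cvg Nm) => // w _.
apply: cvg_near_cst; exact: near_Nm.
Qed.

Let mU : measurable_fun [set: T] U.
Proof.
move=> _ F mF; rewrite setTI -[_ @^-1` _]setTI -(preimage_setT L).
by apply: Gm; exact: GLU.
Qed.

Let mL : measurable_fun [set: T] L.
Proof.
move=> _ F mF; rewrite setTI -[_ @^-1` _]setIT -(preimage_setT U).
by apply: Gm; exact: GLU.
Qed.

Let width m w : R :=
  grid_point m (grid_index m (U w) + 1) - grid_point m (grid_index m (L w)).

Let width_ge0 m w : 0 <= width m w.
Proof.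
rewrite subr_ge0; have /andP[lL _] := grid_itv m (L w).
have /andP[_ /ltW] := grid_itv m (U w).
by apply: le_trans; exact: le_trans (LU w).
Qed.

Let boxwidth m w : fine (lebesgue_measure (box m (Z m w))) = width m w.
Proof.
rewrite boxZ lebesgue_measure_itv/= lte_fin; case: ltP => [//|].
by rewrite -subr_le0 => w0; apply/eqP; rewrite /= eq_le width_ge0.
Qed.

Let law_Nm m n : (P [set w | Nm m w = n%:R%:E] =
  \int[P]_w (poisson_mass (lambda * width m w) n)%:E)%E.
Proof.
pose E c := [set w | number_of_points A (box m c) w = n%:R%:E].
pose r c := poisson_mass (lambda * fine (lebesgue_measure (box m c))) n.
have leb_fin c : (lebesgue_measure (box m c) < +oo)%E.
  by rewrite /box lebesgue_measure_itv/=; case: ifP => _; rewrite ltry.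
transitivity (\int[P]_w (r (Z m w))%:E)%E; last first.
  by apply: eq_integral => w _; rewrite /r boxwidth.
have EE c : E c = [set: T] `&` number_of_points A (box m c) @^-1` [set n%:R%:E].
  by rewrite setTI.
apply: (@probability_selection _ _ _ (Z m) (mZ m) P E r).
- by move=> c; rewrite EE; apply: (ppp_measurable hA).
- move=> c; rewrite poisson_mass_ge0// mulr_ge0 ?fine_ge0//; exact: ltW.
- move=> c; rewrite -(ppp_law hA (mbox m c) (leb_fin c)) [RHS]muleC setIC.
  apply: AG; last exact: GZ.
  by apply: sub_sigma_algebra; exists (box m c) => //; exists [set n%:R%:E].
Qed.

(** By independence the law of each approximating count is a Poisson mixture
    ([law_Nm]); both sides of this identity converge boundedly. *)
Lemma law_count_random_interval n :
  (P [set w | N w = n%:R%:E] =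
   \int[P]_w (poisson_mass (lambda * (U w - L w)) n)%:E)%E.
Proof.
have mpm : measurable_fun [set: R] (fun x : R => poisson_mass (lambda * x) n).
  apply: (@measurableT_comp _ _ _ _ _ _ (@poisson_mass R ^~ n)) => //.
  by apply: continuous_measurable_fun; exact: continuous_poisson_mass.
have int1 : P.-integrable [set: T] (cst 1%E).
  exact: finite_measure_integrable_cst.
pose In (g : T -> \bar R) := \1_[set w | g w = n%:R%:E] : T -> R.
have mset (g : T -> \bar R) : measurable_fun [set: T] g ->
    measurable [set w | g w = n%:R%:E].
  by move=> mg; have := mg measurableT [set n%:R%:E]; rewrite setTI; exact.
have intIn (g : T -> \bar R) : measurable_fun [set: T] g ->
    (\int[P]_w (In g w)%:E = P [set w | g w = n%:R%:E])%E.
  by move=> /mset me; rewrite integral_indic// setIT.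
have mIn (g : T -> \bar R) : measurable_fun [set: T] g ->
    measurable_fun [set: T] (EFin \o In g).
  by move=> mg; apply/measurable_EFinP/measurable_indic; exact: mset.
have cI : ((\int[P]_w (In (Nm m) w)%:E) @[m --> \oo] -->
    \int[P]_w (In N w)%:E)%E.
  apply: dominated_cvg int1 _ => //.
  - by move=> m; apply: mIn.
  - move=> w _; apply: cvg_near_cst.
    have := near_Nm w; apply: filterS => m NmN.
    by rewrite /In /= !indicE; congr (nat_of_bool _)%:R%:E; apply/idP/idP;
      rewrite !inE/= NmN.
  - by move=> m w _; rewrite /In /= ger0_norm// lee_fin indicE lern1 leq_b1.
have mwidth m : measurable_fun [set: T] (width m).
  rewrite (_ : width m = fun w => fine (lebesgue_measure (box m (Z m w)))).
    by apply: (@measurable_selection _ _ _ (mZ m) _ _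
      (fun c _ => fine (lebesgue_measure (box m c)))).
  by apply/funext => w; rewrite boxwidth.
have cW : ((\int[P]_w (poisson_mass (lambda * width m w) n)%:E) @[m --> \oo] -->
    \int[P]_w (poisson_mass (lambda * (U w - L w)) n)%:E)%E.
  apply: dominated_cvg int1 _ => //.
  - by move=> m; apply/measurable_EFinP; exact: (measurableT_comp mpm).
  - move=> w _; apply: cvg_EFin; first exact: nearW.
    apply: (@cvg_comp _ _ _ (fun m => lambda * width m w)
      (@poisson_mass R ^~ n)); last first.
      exact: continuous_poisson_mass.
    apply: cvgM; first exact: cvg_cst.
    by apply: cvgB; [exact: grid_up_cvg|exact: grid_lo_cvg].
  - move=> m w _; rewrite /= ger0_norm ?lee_fin ?poisson_mass_ge0 ?poisson_mass_le1//;
    by rewrite mulr_ge0// ltW.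
rewrite -intIn; last exact: measurable_count_random_interval.
apply: (cvg_unique _ cI) => //; apply: cvg_trans cW; apply: near_eq_cvg.
by apply: nearW => m; rewrite -law_Nm intIn.
Qed.

End random_interval.

(** * Spacings of the typical sequence *)

Section typical_point.
Context d (T : measurableType d) (R : realType) (P : probability T R).
Context (B : int -> {RV P >-> R}).

Lemma sum_spacing (a : int) n w :
  \sum_(j <- [seq a + 1 + Posz l | l <- iota 0 n]) spacing B j w =
  B (a + n) w - B a w.
Proof.
elim: n => [|n IH]; first by rewrite /= big_nil addr0 subrr.
rewrite -addn1 iotaD map_cat big_cat/= IH big_seq1 add0n /spacing/=.
have -> : a + 1 + Posz n - 1 = a + Posz n by lia.
have -> : a + 1 + Posz n = a + Posz (n + 1)%N by lia.
by rewrite addrC subrKA.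
Qed.

Lemma sigma_generated_B_measurable :
  sigma_generated [set: int] (fun i => B i : T -> R) `<=` measurable.
Proof.
apply: smallest_sub; first exact: sigma_algebra_measurable.
move=> _ [i _ [F mF <-]]; rewrite setTI -[X in measurable X]setTI.
exact: measurable_funPT.
Qed.

(** The generated sigma-algebra is taken as the measurable structure of the
    sample space, for which the [B j] are measurable by construction. *)
Lemma sigma_generated_kmid k (i j : int) (F F' : set R) :
  measurable F -> measurable F' ->
  sigma_generated [set: int] (fun i => B i : T -> R)
    ((fun w => kmid k (B^~ w) i) @^-1` F `&` (fun w => kmid k (B^~ w) j) @^-1` F').
Proof.
move=> mF mF'.
pose S := \bigcup_(i in [set: int]) preimage_set_system [set: T] (B i) measurable.
have mB l : measurable_fun [set: g_sigma_algebraType S] (B l : T -> R).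
  by move=> _ E mE; apply: sub_sigma_algebra; exists l => //; exists E.
have mM l : measurable_fun [set: g_sigma_algebraType S] (fun w => kmid k (B^~ w) l).
  by apply: measurable_funM => //; exact: measurable_funD.
have mpre l E : measurable E ->
    measurable ((fun w : g_sigma_algebraType S => kmid k (B^~ w) l) @^-1` E).
  by move=> mE; rewrite -[X in measurable X]setTI; exact: mM.
by apply: (measurableI _ _ (mpre i _ mF) (mpre j _ mF')).
Qed.

Section exponential_spacings.
Context (lambdaB : R).
Hypotheses (lambdaB0 : 0 < lambdaB) (hB : typical_poisson_sequence lambdaB B).

Lemma spacing_ge0 i w : 0 <= spacing B i w.
Proof.
by rewrite /spacing/= subr_ge0 ltW// (tps_increasing hB)// ltrBlDr ltrDl.
Qed.

Lemma integral_poisson_mass_spacing c i m : 0 < c ->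
  (\int[P]_w (poisson_mass (c * `|spacing B i w|) m)%:E =
   (lambdaB / (lambdaB + c) * (c / (lambdaB + c)) ^+ m)%:E)%E.
Proof.
move=> c0; rewrite -integral_exponential_poisson_mass//.
under [RHS]eq_integral do rewrite EFinM.
pose g (x : R) := (poisson_mass (c * `|x|) m)%:E.
have := @eq_weighted_integral R _ R _ T P (cst 1) (spacing B i)
  _ (measurableTypeR R) (@lebesgue_measure R) (exponential_pdf lambdaB) id.
move=> /(_ _ _ _ _ _ _ _ g)/= <-//.
- by apply: eq_integral => w _; rewrite mul1e.
- exact: measurable_exponential_pdf.
- by move=> x; apply: exponential_pdf_ge0; exact: ltW.
- move=> F mF; transitivity (P (spacing B i @^-1` F)).
    under eq_integral do rewrite mul1e.
    rewrite (_ : (\int[P]_x _)%E = (\int[P]_x (\1_(spacing B i @^-1` F) x)%:E)%E)//.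
    rewrite integral_indic ?setIT// -[X in measurable X]setTI.
    exact: measurable_funPT.
  have /= := tps_law hB i mF; rewrite /distribution /pushforward => ->.
  rewrite /exponential_prob [LHS]integral_mkcond; apply: eq_integral => x _.
  by rewrite patchE indicE; case: (x \in F); rewrite ?mule1 ?mule0.
- apply/measurable_EFinP.
  apply: (@measurableT_comp _ _ _ _ _ _ (@poisson_mass R ^~ m) _ (fun x : R => c * `|x|)).
    by apply: continuous_measurable_fun; exact: continuous_poisson_mass.
  by apply: measurable_funM => //; exact: measurable_normr.
- by move=> x; rewrite lee_fin poisson_mass_ge0// mulr_ge0// ltW.
Qed.

End exponential_spacings.

End typical_point.

Theorem theorem3 (R : realType) (d : measure_display) (T : measurableType d)
    (P : probability T R) (lambdaA lambdaB : R)
    (hlambdaA : 0 < lambdaA) (hlambdaB : 0 < lambdaB)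
    (k : nat) (hk : (1 <= k)%N)
    (A : T -> set R) (hA : poisson_point_process P lambdaA A)
    (B : int -> {RV P >-> R}) (hB : typical_poisson_sequence lambdaB B)
    (hAB : independent_processes A B)
    (i : int) :
  let D_B : T -> \bar R := fun w => B_degree k (A w) (fun j => B j w) i in
  measurable_fun [set: T] D_B /\
  forall n : nat,
    P [set w | D_B w = n%:R%:E] =
      (Gamma (2 * k + n)%:R / (n`!%:R * Gamma (2 * k)%:R) *
       ((2 * lambdaB) ^+ (2 * k) * lambdaA ^+ n /
        (2 * lambdaB + lambdaA) ^+ (2 * k + n)))%:E.
Proof.
move=> D_B.
pose L w := kmid k (B^~ w) (i - Posz k).
pose U w := kmid k (B^~ w) i.
have k0 : (0 < k)%N by [].
have DE w : D_B w = counting (A w `&` `[L w, U w]).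
  rewrite /D_B /B_degree; congr counting; apply/seteqP; split=> a /=.
    move=> [Aa /AB_edgeP E]; split => //; rewrite in_itv/=.
    by apply: E => // x y; exact: (tps_increasing hB).
  rewrite in_itv/= => -[Aa aLU]; split => //; apply/AB_edgeP => //.
  by move=> x y; exact: (tps_increasing hB).
have LU w : L w <= U w.
  have incB x y : x <= y -> B x w <= B y w.
    by rewrite le_eqVlt => /predU1P[->//|/(tps_increasing hB)/ltW].
  rewrite /L /U /kmid ler_pM2r ?invr_gt0// lerD// incB//; lia.
have GLU := fun F F' => @sigma_generated_kmid _ _ _ _ B k (i - Posz k) i F F'.
have Gm := @sigma_generated_B_measurable _ _ _ _ B.
split.
  rewrite (_ : D_B = fun w => counting (A w `&` `[L w, U w])); last exact/funext.
  exact: (measurable_count_random_interval hA Gm GLU).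
move=> n.
under [X in P X]eq_set do rewrite DE.
rewrite (law_count_random_interval hlambdaA hA LU Gm GLU hAB).
pose c := lambdaA / 2.
have c0 : 0 < c by rewrite divr_gt0.
pose s := [seq (i - Posz k) + 1 + Posz l | l <- iota 0 (2 * k)].
have us : uniq s.
  by rewrite map_inj_uniq ?iota_uniq// => x y /addrI [].
have ss : size s = (2 * k)%N by rewrite size_map size_iota.
(* The interval has half the length of the [2 * k] spacings around [B i]. *)
have -> : (\int[P]_w (poisson_mass (lambdaA * (U w - L w)) n)%:E =
    \int[P]_w (poisson_mass (c * \sum_(j <- s) spacing B j w) n)%:E)%E.
  apply: eq_integral => w _; congr (poisson_mass _ _)%:E.
  rewrite sum_spacing /U /L /kmid /c subrK.
  have -> : i - Posz k + Posz (2 * k)%N = i + k by lia.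
  by field.
rewrite (integral_poisson_mass_sum c0 _ _ _
  (fun j m => integral_poisson_mass_spacing hlambdaB hB j m c0))//.
- rewrite ss; congr EFin.
  have k2 : (2 * k = (2 * k).-1.+1)%N by lia.
  have -> : Gamma (2 * k)%:R = (2 * k).-1`!%:R :> R by rewrite {1}k2 Gamma_natE.
  have -> : Gamma (2 * k + n)%:R = (2 * k + n).-1`!%:R :> R.
    by rewrite -Gamma_natE prednK//; lia.
  have -> : ((2 * k + n).-1`! = 'C((2 * k + n).-1, n) * (n`! * (2 * k).-1`!))%N.
    by rewrite -(@bin_fact (2 * k + n).-1 n); [congr (_ * (_ * _`!))%N; lia|lia].
  have lc : lambdaB + c = (2 * lambdaB + lambdaA) / 2 by rewrite /c; field.
  rewrite lc exprD !natrM.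
  have -> : lambdaB / ((2 * lambdaB + lambdaA) / 2) =
      2 * lambdaB / (2 * lambdaB + lambdaA).
    by field; lra.
  have -> : c / ((2 * lambdaB + lambdaA) / 2) = lambdaA / (2 * lambdaB + lambdaA).
    by rewrite /c; field; lra.
  rewrite !expr_div_n.
  field.
  by rewrite !expf_neq0 ?pnatr_eq0 -?lt0n ?fact_gt0//; lra.
- exact: (spacing_ge0 hB).
- exact: (tps_independent hB).
Qed.
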